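(* Let $\kappa,\nu>0$ and consider, with $\Psi(\theta)=\sin(\theta)$, the equation $$\partial_t g-\kappa\,\partial_\theta\big(g\,(\Psi*g)\big)=\nu\,\partial_\theta^2 g,\qquad\theta\in\mathbb T .$$ Then: - if $\frac\kappa\nu<2$, the constant state $g\equiv\frac1{2\pi}$ is linearly stable; - if $\frac\kappa\nu>2$, the constant state $g\equiv\frac1{2\pi}$ is linearly unstable.
   Context: $\mathbb T=\mathbb R/2\pi\mathbb Z$; $(\Psi*g)(\theta)=\int_{\mathbb T}\Psi(\theta-w)g(w)\,dw$. Linear stability refers to the linearization about $\frac1{2\pi}$, $$\partial_t\tilde g-\frac{\kappa}{2\pi}\partial_\theta(\Psi*\tilde g)=\nu\,\partial_\theta^2\tilde g .$$ The constant state is linearly stable if every Fourier mode $\ell\ne0$ of every solution $\tilde g$ decays exponentially in time; it is linearly unstable if some Fourier mode $\ell\neq0$ is a growing mode (solutions with a nonzero $\ell$-th coefficient have that coefficient growing exponentially in time). *)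

(* Defs.v *)
From Stdlib Require Import Reals Lra ZArith.
From Coquelicot Require Import Coquelicot.

Open Scope R_scope.

(* Functions on the torus R / 2 PI Z are 2 PI-periodic functions on R, and the
   integral over the torus is the integral over [0, 2 PI]. *)
Definition periodic2PI (f : R -> R) : Prop :=
  forall x, f (x + 2 * PI) = f x.

Definition conv (Psi g : R -> R) (theta : R) : R :=
  RInt (fun w => Psi (theta - w) * g w) 0 (2 * PI).

(* The equation reads d_t g = evolution_rhs kappa nu Psi g. *)
Definition evolution_rhs (kappa nu : R) (Psi g : R -> R) (theta : R) : R :=
  kappa * Derive (fun x => g x * conv Psi g x) theta + nu * Derive_n g 2 theta.

Definition linearized_rhs (kappa nu : R) (Psi g : R -> R) (theta : R) : R :=
  kappa / (2 * PI) * Derive (conv Psi g) theta + nu * Derive_n g 2 theta.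

(* For mean-zero kernels (such as sin), linearized_rhs is the directional
   derivative of evolution_rhs at the constant state 1 / (2 PI). *)
Lemma linearized_rhs_spec (kappa nu : R) (Psi h : R -> R) (theta : R) :
  (forall x, is_RInt (fun w => Psi (x - w)) 0 (2 * PI) 0) ->
  (forall x, ex_RInt (fun w => Psi (x - w) * h w) 0 (2 * PI)) ->
  ex_derive (conv Psi h) theta ->
  (forall x, ex_derive h x) ->
  is_derive
    (fun eps => evolution_rhs kappa nu Psi (fun x => / (2 * PI) + eps * h x) theta)
    0 (linearized_rhs kappa nu Psi h theta).
Proof.
intros HPsi Hint Hconv Hh.
assert (Hc : forall eps x,
  conv Psi (fun y => / (2 * PI) + eps * h y) x = eps * conv Psi h x).
{ intros eps x. unfold conv. apply is_RInt_unique.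
  apply (is_RInt_ext (fun w => plus (scal (/ (2 * PI)) (Psi (x - w)))
                                    (scal eps (Psi (x - w) * h w)))).
  { intros w _. unfold plus, scal; simpl; unfold mult; simpl. ring. }
  replace (eps * RInt (fun w => Psi (x - w) * h w) 0 (2 * PI)) with
    (plus (scal (/ (2 * PI)) 0)
          (scal eps (RInt (fun w => Psi (x - w) * h w) 0 (2 * PI)))).
  2:{ unfold plus, scal; simpl; unfold mult; simpl. ring. }
  apply @is_RInt_plus; apply @is_RInt_scal;
    [apply HPsi | apply (RInt_correct (V := R_CompleteNormedModule)), Hint]. }
apply (is_derive_ext (fun eps =>
  kappa * (/ (2 * PI) * (eps * Derive (conv Psi h) theta)
           + eps * eps * (Derive h theta * conv Psi h theta
                          + h theta * Derive (conv Psi h) theta))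
  + nu * (eps * Derive_n h 2 theta))).
{ intros eps. unfold evolution_rhs. symmetry.
  assert (H1 : Derive (fun x => (/ (2 * PI) + eps * h x)
        * conv Psi (fun y => / (2 * PI) + eps * h y) x) theta
      = / (2 * PI) * (eps * Derive (conv Psi h) theta)
           + eps * eps * (Derive h theta * conv Psi h theta
                          + h theta * Derive (conv Psi h) theta)).
  { rewrite (Derive_ext _ (fun x => (/ (2 * PI) + eps * h x)
                                    * (eps * conv Psi h x))).
    2:{ intros x. now rewrite Hc. }
    apply is_derive_unique. auto_derive.
    { repeat split; auto. }
    change (Derive (fun x => h x)) with (Derive h).
    change (Derive (fun x => conv Psi h x)) with (Derive (conv Psi h)). ring. }
  assert (H2 : Derive_n (fun x => / (2 * PI) + eps * h x) 2 theta
               = eps * Derive_n h 2 theta).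
  { simpl. rewrite (Derive_ext _ (fun x => eps * Derive h x)).
    - apply Derive_scal.
    - intros x. apply is_derive_unique. auto_derive; auto.
      change (Derive (fun x => h x)) with (Derive h). ring. }
  rewrite H1, H2. reflexivity. }
unfold linearized_rhs. auto_derive; auto.
change (Derive (fun x => Derive (fun y => h y) x) theta) with (Derive_n h 2 theta).
unfold Rdiv. ring.
Qed.

(* Global classical solutions, g t theta: C^{1,2} for t > 0, with continuous
   initial data attained at t = 0. Values at t < 0 are irrelevant. *)
Record linearized_solution (kappa nu : R) (Psi : R -> R) (g : R -> R -> R) : Prop := {
  sol_periodic : forall t, 0 <= t -> periodic2PI (g t);
  sol_cont : continuous_on (fun p : R * R => 0 <= fst p)
               (fun p : R * R => g (fst p) (snd p));
  sol_ex_dt : forall t theta, 0 < t -> ex_derive (fun s => g s theta) t;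
  sol_ex_dtheta : forall t theta, 0 < t -> ex_derive (g t) theta;
  sol_ex_dtheta2 : forall t theta, 0 < t -> ex_derive_n (g t) 2 theta;
  sol_cont_dt : continuous_on (fun p : R * R => 0 < fst p)
                  (fun p : R * R => Derive (fun s => g s (snd p)) (fst p));
  sol_cont_dtheta : continuous_on (fun p : R * R => 0 < fst p)
                      (fun p : R * R => Derive (g (fst p)) (snd p));
  sol_cont_dtheta2 : continuous_on (fun p : R * R => 0 < fst p)
                       (fun p : R * R => Derive_n (g (fst p)) 2 (snd p));
  sol_eq : forall t theta, 0 < t ->
    Derive (fun s => g s theta) t = linearized_rhs kappa nu Psi (g t) theta
}.

(* (1 / 2 PI) times the integral of f(theta) exp(- i l theta). *)
Definition fourier_coeff (f : R -> R) (l : Z) : C :=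
  scal (/ (2 * PI))
    (RInt (V := C_R_CompleteNormedModule)
       (fun theta => (f theta * cos (IZR l * theta), - (f theta * sin (IZR l * theta))))
       0 (2 * PI)).

Definition decays_exponentially (u : R -> C) : Prop :=
  exists K lambda : R, 0 < lambda /\
    forall t, 0 <= t -> Cmod (u t) <= K * exp (- lambda * t).

Definition grows_exponentially (u : R -> C) : Prop :=
  exists c lambda : R, 0 < c /\ 0 < lambda /\
    forall t, 0 <= t -> c * exp (lambda * t) <= Cmod (u t).

Definition linearly_stable (kappa nu : R) (Psi : R -> R) : Prop :=
  forall g, linearized_solution kappa nu Psi g ->
  forall l : Z, l <> 0%Z ->
    decays_exponentially (fun t => fourier_coeff (g t) l).

Definition excites_mode (g : R -> R -> R) (l : Z) : Prop :=
  exists t, 0 <= t /\ fourier_coeff (g t) l <> RtoC 0.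

(* The first conjunct excludes modes that grow only vacuously. *)
Definition growing_mode (kappa nu : R) (Psi : R -> R) (l : Z) : Prop :=
  (exists g, linearized_solution kappa nu Psi g /\ excites_mode g l) /\
  (forall g, linearized_solution kappa nu Psi g -> excites_mode g l ->
     grows_exponentially (fun t => fourier_coeff (g t) l)).

Definition linearly_unstable (kappa nu : R) (Psi : R -> R) : Prop :=
  exists l : Z, l <> 0%Z /\ growing_mode kappa nu Psi l.

(* Main.v *)
(* The Fourier coefficients diagonalise the linearised equation. Since
   [f |-> (sin * f)'] is [PI] times the projection onto span (cos, sin) and the
   Laplacian is symmetric on the torus, the cos and sin coefficients of order [l]
   of any solution satisfy [u' = lambda_l u], where
   [lambda_l = kappa / 2 - nu] for [l = 1, -1] and [lambda_l = - nu l^2] for the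
   other [l <> 0]. Hence only [l = 1, -1] can grow, exactly when
   [kappa / nu > 2], and [exp ((kappa / 2 - nu) t) cos theta] excites them. *)
Require Import Defs.
From Stdlib Require Import Reals.
From Coquelicot Require Import Coquelicot.
From Stdlib Require Import Lra Lia ZArith.
Open Scope R_scope.

(** * Continuity and integrability preliminaries *)

Lemma le_0_2PI : 0 <= 2 * PI.
Proof. pose proof PI_RGT_0; lra. Qed.

Lemma ex_RInt_mult (f h : R -> R) (a b : R) :
  (forall x, continuous f x) -> (forall x, continuous h x) ->
  ex_RInt (fun x => f x * h x) a b.
Proof.
intros Hf Hh. apply (ex_RInt_continuous (V := R_CompleteNormedModule)).
intros x _. apply (continuous_mult (K := R_AbsRing)); auto.
Qed.

Lemma continuous_sin (x : R) : continuous sin x.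
Proof.
apply (ex_derive_continuous (K := R_AbsRing) (V := R_NormedModule)).
auto_derive; auto.
Qed.

Lemma continuous_cos (x : R) : continuous cos x.
Proof.
apply (ex_derive_continuous (K := R_AbsRing) (V := R_NormedModule)).
auto_derive; auto.
Qed.

Lemma is_RInt_lin2 (f h : R -> R) (a b p q If Ih : R) :
  is_RInt f a b If -> is_RInt h a b Ih ->
  is_RInt (fun x => p * f x + q * h x) a b (p * If + q * Ih).
Proof.
intros Hf Hh.
apply (is_RInt_plus (V := R_NormedModule) (fun x => p * f x) (fun x => q * h x));
  apply (is_RInt_scal (V := R_NormedModule)); assumption.
Qed.

(** * Convolution with the sine kernel *)

(** The addition formula for [sin (theta - w)] separates the variables, so the convolution has rank
    two: only the first cosine and sine moments of [f] survive. *)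
Lemma conv_sin (f : R -> R) (theta : R) :
  (forall x, continuous f x) ->
  conv sin f theta =
  RInt (fun w => f w * cos w) 0 (2 * PI) * sin theta
  - RInt (fun w => f w * sin w) 0 (2 * PI) * cos theta.
Proof.
intros Hf. unfold conv. apply is_RInt_unique.
apply (is_RInt_ext
  (fun w => sin theta * (f w * cos w) + - cos theta * (f w * sin w))).
{ intros w _. rewrite sin_minus. simpl. ring. }
replace (_ - _) with
  (sin theta * RInt (fun w => f w * cos w) 0 (2 * PI)
   + - cos theta * RInt (fun w => f w * sin w) 0 (2 * PI)) by ring.
apply is_RInt_lin2; apply (RInt_correct (V := R_CompleteNormedModule));
  apply ex_RInt_mult; auto using continuous_sin, continuous_cos.
Qed.

Lemma linearized_rhs_sin (kappa nu : R) (f : R -> R) (theta : R) :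
  (forall x, continuous f x) ->
  linearized_rhs kappa nu sin f theta =
  kappa / (2 * PI) *
    (RInt (fun w => f w * cos w) 0 (2 * PI) * cos theta
     + RInt (fun w => f w * sin w) 0 (2 * PI) * sin theta)
  + nu * Derive_n f 2 theta.
Proof.
intros Hf. unfold linearized_rhs. f_equal. f_equal.
rewrite (Derive_ext _ _ _ (fun x => conv_sin f x Hf)).
(* The moments do not depend on [theta]; abstracting them lets [auto_derive] treat them as
   constants. *)
generalize (RInt (fun w => f w * cos w) 0 (2 * PI)) as A.
generalize (RInt (fun w => f w * sin w) 0 (2 * PI)) as B. intros B A.
apply is_derive_unique. auto_derive; auto. ring.
Qed.

(** * The Laplacian on the torus: symmetry and eigenfunctions *)

(** Periodicity is recorded only at the endpoints, for the function and its first derivative: this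
    is what cancels the boundary terms in integration by parts. *)
Record torus_C2 (f f1 f2 : R -> R) : Prop := {
  torus_C2_d1 : forall x, is_derive f x (f1 x);
  torus_C2_d2 : forall x, is_derive f1 x (f2 x);
  torus_C2_cont : forall x, continuous f2 x;
  torus_C2_per : f (2 * PI) = f 0;
  torus_C2_per1 : f1 (2 * PI) = f1 0
}.

Lemma torus_C2_continuous (f f1 f2 : R -> R) :
  torus_C2 f f1 f2 -> forall x, continuous f x.
Proof.
intros Hf x. apply (ex_derive_continuous (K := R_AbsRing) (V := R_NormedModule)).
exists (f1 x). apply Hf.
Qed.

(** Green's identity: [f2 * e - f * e2] is the derivative of the Wronskian [f1 * e - f * e1], which
    takes equal values at [0] and [2 * PI]. *)
Lemma RInt_laplacian_symmetric (f f1 f2 e e1 e2 : R -> R) :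
  torus_C2 f f1 f2 -> torus_C2 e e1 e2 ->
  RInt (fun x => f2 x * e x) 0 (2 * PI) = RInt (fun x => f x * e2 x) 0 (2 * PI).
Proof.
intros Hf He.
assert (H : is_RInt (fun x => f2 x * e x - f x * e2 x) 0 (2 * PI) 0).
{ replace 0 with (minus (f1 (2 * PI) * e (2 * PI) - f (2 * PI) * e1 (2 * PI))
                        (f1 0 * e 0 - f 0 * e1 0)) at 2.
  2:{ rewrite (torus_C2_per _ _ _ Hf), (torus_C2_per1 _ _ _ Hf),
        (torus_C2_per _ _ _ He), (torus_C2_per1 _ _ _ He).
      unfold minus, plus, opp; simpl. ring. }
  apply (is_RInt_derive (V := R_CompleteNormedModule)
           (fun x => f1 x * e x - f x * e1 x)).
  - intros x _.
    pose proof (torus_C2_d1 _ _ _ Hf x) as F1.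
    pose proof (torus_C2_d2 _ _ _ Hf x) as F2.
    pose proof (torus_C2_d1 _ _ _ He x) as E1.
    pose proof (torus_C2_d2 _ _ _ He x) as E2.
    auto_derive.
    + repeat split; eexists; eassumption.
    + change (Derive (fun x => f x)) with (Derive f).
      change (Derive (fun x => f1 x)) with (Derive f1).
      change (Derive (fun x => e x)) with (Derive e).
      change (Derive (fun x => e1 x)) with (Derive e1).
      rewrite (is_derive_unique _ _ _ F1), (is_derive_unique _ _ _ F2),
        (is_derive_unique _ _ _ E1), (is_derive_unique _ _ _ E2). ring.
  - intros x _. apply (continuous_minus (V := R_NormedModule));
      apply (continuous_mult (K := R_AbsRing));
      solve [apply Hf | apply He | eapply torus_C2_continuous; eassumption]. }
apply (is_RInt_unique (V := R_CompleteNormedModule)) in H.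
assert (H' := RInt_minus (V := R_CompleteNormedModule)
  (fun x => f2 x * e x) (fun x => f x * e2 x) 0 (2 * PI)).
unfold minus, plus, opp in H'; simpl in H'.
unfold Rminus in H. rewrite H' in H.
- lra.
- apply ex_RInt_mult; [apply Hf | eapply torus_C2_continuous; eassumption].
- apply ex_RInt_mult; [eapply torus_C2_continuous; eassumption | apply He].
Qed.

(** An eigenfunction of the Laplacian on the torus: [e'' = - L e]. *)
Definition harmonic (L : R) (e : R -> R) : Prop :=
  exists e1, torus_C2 e e1 (fun x => - L * e x).

Lemma harmonic_continuous (L : R) (e : R -> R) :
  harmonic L e -> forall x, continuous e x.
Proof. intros [e1 He]. eapply torus_C2_continuous; eassumption. Qed.

Lemma RInt_laplacian_harmonic (f f1 f2 e : R -> R) (L : R) :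
  torus_C2 f f1 f2 -> harmonic L e ->
  RInt (fun x => f2 x * e x) 0 (2 * PI) = - L * RInt (fun x => f x * e x) 0 (2 * PI).
Proof.
intros Hf He. pose proof (harmonic_continuous _ _ He) as Hc. destruct He as [e1 He].
rewrite (RInt_laplacian_symmetric _ _ _ _ _ _ Hf He).
rewrite <- (RInt_scal (V := R_CompleteNormedModule) (fun x => f x * e x)).
- apply RInt_ext. intros x _. unfold scal; simpl; unfold mult; simpl. ring.
- apply ex_RInt_mult; auto. eapply torus_C2_continuous; eassumption.
Qed.

(** Eigenfunctions of a symmetric operator with distinct eigenvalues: moving the Laplacian from one
    factor to the other gives [(L - M)] times the integral equal to 0. *)
Lemma RInt_harmonic_orthogonal (L M : R) (e f : R -> R) :
  harmonic L e -> harmonic M f -> L <> M ->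
  RInt (fun x => f x * e x) 0 (2 * PI) = 0.
Proof.
intros He Hf HLM. pose proof (harmonic_continuous _ _ He) as Hec.
pose proof (harmonic_continuous _ _ Hf) as Hfc. destruct Hf as [f1 Hf].
pose proof (RInt_laplacian_harmonic _ _ _ _ _ Hf He) as H.
rewrite (RInt_ext _ (fun x => scal (- M) (f x * e x))) in H.
2:{ intros x _. unfold scal; simpl; unfold mult; simpl. ring. }
rewrite (RInt_scal (V := R_CompleteNormedModule)) in H by (apply ex_RInt_mult; auto).
unfold scal in H; simpl in H; unfold mult in H; simpl in H.
apply (Rmult_eq_reg_l (L - M)); lra.
Qed.

(** * Trigonometric modes and their inner products *)

Lemma sin_2PI_Z (l : Z) : sin (IZR l * (2 * PI)) = 0.
Proof.
apply sin_eq_0_1. exists (2 * l)%Z. rewrite mult_IZR. ring.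
Qed.

Lemma cos_2PI_Z (l : Z) : cos (IZR l * (2 * PI)) = 1.
Proof.
replace (IZR l * (2 * PI)) with (2 * (IZR l * PI)) by ring.
rewrite cos_2a_sin, (sin_eq_0_1 (IZR l * PI)); [ring | now exists l].
Qed.

Lemma harmonic_cos (l : Z) : harmonic (IZR l * IZR l) (fun x => cos (IZR l * x)).
Proof.
exists (fun x => - IZR l * sin (IZR l * x)). split.
- intros x. auto_derive; auto. ring.
- intros x. auto_derive; auto. ring.
- intros x. apply (ex_derive_continuous (K := R_AbsRing) (V := R_NormedModule)).
  auto_derive; auto.
- now rewrite cos_2PI_Z, (Rmult_0_r (IZR l)), cos_0.
- now rewrite sin_2PI_Z, (Rmult_0_r (IZR l)), sin_0.
Qed.

Lemma harmonic_sin (l : Z) : harmonic (IZR l * IZR l) (fun x => sin (IZR l * x)).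
Proof.
exists (fun x => IZR l * cos (IZR l * x)). split.
- intros x. auto_derive; auto. ring.
- intros x. auto_derive; auto. ring.
- intros x. apply (ex_derive_continuous (K := R_AbsRing) (V := R_NormedModule)).
  auto_derive; auto.
- now rewrite sin_2PI_Z, (Rmult_0_r (IZR l)), sin_0.
- now rewrite cos_2PI_Z, (Rmult_0_r (IZR l)), cos_0.
Qed.

Lemma RInt_cos_cos : RInt (fun x => cos x * cos x) 0 (2 * PI) = PI.
Proof.
apply is_RInt_unique.
replace PI with (minus ((2 * PI + sin (2 * PI) * cos (2 * PI)) / 2)
                       ((0 + sin 0 * cos 0) / 2)) at 2.
2:{ rewrite sin_2PI, sin_0. unfold minus, plus, opp; simpl. field. }
apply (is_RInt_derive (V := R_CompleteNormedModule)
         (fun x => (x + sin x * cos x) / 2)).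
- intros x _. auto_derive; auto. pose proof (sin2_cos2 x). unfold Rsqr in *. nra.
- intros x _. apply (continuous_mult (K := R_AbsRing)); apply continuous_cos.
Qed.

Lemma RInt_sin_sin : RInt (fun x => sin x * sin x) 0 (2 * PI) = PI.
Proof.
apply is_RInt_unique.
replace PI with (minus ((2 * PI - sin (2 * PI) * cos (2 * PI)) / 2)
                       ((0 - sin 0 * cos 0) / 2)) at 2.
2:{ rewrite sin_2PI, sin_0. unfold minus, plus, opp; simpl. field. }
apply (is_RInt_derive (V := R_CompleteNormedModule)
         (fun x => (x - sin x * cos x) / 2)).
- intros x _. auto_derive; auto. pose proof (sin2_cos2 x). unfold Rsqr in *. nra.
- intros x _. apply (continuous_mult (K := R_AbsRing)); apply continuous_sin.
Qed.

Lemma RInt_sin_cos : RInt (fun x => sin x * cos x) 0 (2 * PI) = 0.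
Proof.
apply is_RInt_unique.
replace 0 with (minus (sin (2 * PI) * sin (2 * PI) / 2) (sin 0 * sin 0 / 2)) at 2.
2:{ rewrite sin_2PI, sin_0. unfold minus, plus, opp; simpl. field. }
apply (is_RInt_derive (V := R_CompleteNormedModule) (fun x => sin x * sin x / 2)).
- intros x _. auto_derive; auto. field.
- intros x _. apply (continuous_mult (K := R_AbsRing));
    [apply continuous_sin | apply continuous_cos].
Qed.

Lemma RInt_cos_sin : RInt (fun x => cos x * sin x) 0 (2 * PI) = 0.
Proof.
etransitivity; [| apply RInt_sin_cos]. apply RInt_ext. intros x _. apply Rmult_comm.
Qed.

(** * Action of the kernel on the Fourier modes *)

(* The operator [f |-> (sin * f)'] is [PI] times the orthogonal projection onto
   span (cos, sin); [kernel_eigenvalue c e] says that [e] is one of its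
   eigenfunctions, with eigenvalue [c], in weak form. *)
Definition kernel_eigenvalue (c : R) (e : R -> R) : Prop :=
  forall f, (forall x, continuous f x) ->
  RInt (fun x => f x * cos x) 0 (2 * PI) * RInt (fun x => cos x * e x) 0 (2 * PI)
  + RInt (fun x => f x * sin x) 0 (2 * PI) * RInt (fun x => sin x * e x) 0 (2 * PI)
  = c * RInt (fun x => f x * e x) 0 (2 * PI).

Lemma kernel_eigenvalue_ext (c : R) (e e' : R -> R) :
  (forall x, e x = e' x) -> kernel_eigenvalue c e -> kernel_eigenvalue c e'.
Proof.
intros Hee He f Hf.
rewrite <- (RInt_ext (fun x => cos x * e x) (fun x => cos x * e' x)),
  <- (RInt_ext (fun x => sin x * e x) (fun x => sin x * e' x)),
  <- (RInt_ext (fun x => f x * e x) (fun x => f x * e' x)); auto;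
  intros; now rewrite Hee.
Qed.

(** Serves the mode [l = -1], where [sin (- x) = - sin x]. *)
Lemma kernel_eigenvalue_opp (c : R) (e : R -> R) :
  (forall x, continuous e x) ->
  kernel_eigenvalue c e -> kernel_eigenvalue c (fun x => - e x).
Proof.
intros Hec He f Hf.
assert (Hopp : forall h, (forall x, continuous h x) ->
  RInt (fun x => h x * - e x) 0 (2 * PI) = - RInt (fun x => h x * e x) 0 (2 * PI)).
{ intros h Hh. rewrite (RInt_ext _ (fun x => opp (h x * e x))).
  - now rewrite (RInt_opp (V := R_CompleteNormedModule)) by (apply ex_RInt_mult; auto).
  - intros x _. unfold opp; simpl. ring. }
rewrite !Hopp by auto using continuous_sin, continuous_cos.
specialize (He f Hf). lra.
Qed.

Lemma kernel_eigenvalue_cos1 : kernel_eigenvalue PI cos.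
Proof. intros f _. rewrite RInt_cos_cos, RInt_sin_cos. ring. Qed.

Lemma kernel_eigenvalue_sin1 : kernel_eigenvalue PI sin.
Proof. intros f _. rewrite RInt_sin_sin, RInt_cos_sin. ring. Qed.

(** [cos] and [sin] have Laplace eigenvalue 1, so [e] is orthogonal to both and the projection kills
    it. *)
Lemma kernel_eigenvalue_orthogonal (L : R) (e : R -> R) :
  harmonic L e -> L <> 1 -> kernel_eigenvalue 0 e.
Proof.
intros He HL f _.
assert (Hcos : harmonic 1 cos).
{ exists (fun x => - sin x). split; intros; try (auto_derive; auto; ring).
  - apply (ex_derive_continuous (K := R_AbsRing) (V := R_NormedModule)).
    auto_derive; auto.
  - now rewrite cos_2PI, cos_0.
  - now rewrite sin_2PI, sin_0. }
assert (Hsin : harmonic 1 sin).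
{ exists cos. split; intros; try (auto_derive; auto; ring).
  - apply (ex_derive_continuous (K := R_AbsRing) (V := R_NormedModule)).
    auto_derive; auto.
  - now rewrite sin_2PI, sin_0.
  - now rewrite cos_2PI, cos_0. }
rewrite (RInt_harmonic_orthogonal _ _ _ _ He Hcos HL),
  (RInt_harmonic_orthogonal _ _ _ _ He Hsin HL). ring.
Qed.

(** The test on [l * l] treats [l = 1] and [l = -1] together. *)
Definition mode_eigenvalue (l : Z) : R := if (l * l =? 1)%Z then PI else 0.

Lemma kernel_eigenvalue_mode (l : Z) :
  kernel_eigenvalue (mode_eigenvalue l) (fun x => cos (IZR l * x)) /\
  kernel_eigenvalue (mode_eigenvalue l) (fun x => sin (IZR l * x)).
Proof.
unfold mode_eigenvalue. destruct (Z.eqb_spec (l * l) 1) as [Hl | Hl].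
- assert (l = 1 \/ l = -1)%Z as [-> | ->] by nia; split.
  + apply (kernel_eigenvalue_ext _ cos); [| apply kernel_eigenvalue_cos1].
    intros x. now rewrite Rmult_1_l.
  + apply (kernel_eigenvalue_ext _ sin); [| apply kernel_eigenvalue_sin1].
    intros x. now rewrite Rmult_1_l.
  + apply (kernel_eigenvalue_ext _ cos); [| apply kernel_eigenvalue_cos1].
    intros x. rewrite <- cos_neg. f_equal. lra.
  + apply (kernel_eigenvalue_ext _ (fun x => - sin x)).
    * intros x. rewrite <- sin_neg. f_equal. lra.
    * apply kernel_eigenvalue_opp;
        [apply continuous_sin | apply kernel_eigenvalue_sin1].
- assert (HL : IZR l * IZR l <> 1).
  { rewrite <- mult_IZR. intros H. apply Hl. now apply eq_IZR. }
  split; eapply kernel_eigenvalue_orthogonal; eauto using harmonic_cos, harmonic_sin.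
Qed.

(** Tested against [e], the kernel term contributes its weak eigenvalue [c] and the diffusion term,
    by symmetry of the Laplacian, contributes [- L]. *)
Lemma RInt_linearized_rhs (kappa nu L c : R) (e f : R -> R) :
  torus_C2 f (Derive f) (Derive_n f 2) -> harmonic L e -> kernel_eigenvalue c e ->
  RInt (fun x => linearized_rhs kappa nu sin f x * e x) 0 (2 * PI) =
  (kappa / (2 * PI) * c - nu * L) * RInt (fun x => f x * e x) 0 (2 * PI).
Proof.
intros Hf He Hc.
pose proof (torus_C2_continuous _ _ _ Hf) as Hfc.
pose proof (harmonic_continuous _ _ He) as Hec.
set (A := RInt (fun w => f w * cos w) 0 (2 * PI)).
set (B := RInt (fun w => f w * sin w) 0 (2 * PI)).
(* The factor [1] gives the integrand the shape of two nested two-term combinations, as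
   [is_RInt_lin2] expects. *)
rewrite (RInt_ext _ (fun x =>
  1 * (kappa / (2 * PI) * A * (cos x * e x) + kappa / (2 * PI) * B * (sin x * e x))
  + nu * (Derive_n f 2 x * e x))).
2:{ intros x _. rewrite linearized_rhs_sin by assumption. fold A B.
    simpl. ring. }
assert (Hi : forall h, (forall x, continuous h x) ->
  is_RInt (fun x => h x * e x) 0 (2 * PI) (RInt (fun x => h x * e x) 0 (2 * PI))).
{ intros h Hh. apply (RInt_correct (V := R_CompleteNormedModule)).
  now apply ex_RInt_mult. }
rewrite (is_RInt_unique _ _ _ _
  (is_RInt_lin2 _ _ _ _ 1 nu _ _
    (is_RInt_lin2 _ _ _ _ (kappa / (2 * PI) * A) (kappa / (2 * PI) * B) _ _
       (Hi cos continuous_cos) (Hi sin continuous_sin))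
    (Hi _ (torus_C2_cont _ _ _ Hf)))).
rewrite (RInt_laplacian_harmonic _ _ _ _ _ Hf He).
specialize (Hc f Hfc). fold A B in Hc.
replace ((kappa / (2 * PI) * c - nu * L) * RInt (fun x => f x * e x) 0 (2 * PI))
  with (kappa / (2 * PI) * (c * RInt (fun x => f x * e x) 0 (2 * PI))
        - nu * L * RInt (fun x => f x * e x) 0 (2 * PI)) by ring.
rewrite <- Hc. simpl. ring.
Qed.

(** * Parameter-dependent integrals and extension in time *)

(** On the compact interval the continuity in the parameter is uniform in [x], so the integrals
    differ by at most the length times a small constant. *)
Lemma continuity_pt_RInt_param (f : R -> R -> R) (a b t : R) :
  a <= b -> (forall s x, continuity_2d_pt f s x) ->
  continuity_pt (fun s => RInt (f s) a b) t.
Proof.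
intros Hab Hf.
assert (Hex : forall s, ex_RInt (f s) a b).
{ intros s. apply (ex_RInt_continuous (V := R_CompleteNormedModule)).
  intros x _. apply continuity_pt_filterlim. intros eps Heps.
  destruct (Hf s x (mkposreal eps Heps)) as [d Hd].
  exists d. split; [apply cond_pos |]. intros y [_ Hy]. apply Hd.
  - rewrite Rminus_diag, Rabs_R0. apply cond_pos.
  - exact Hy. }
intros eps Heps.
(* The [+ 1] covers [a = b] and makes the final bound strict. *)
assert (Heta : 0 < eps / (b - a + 1)) by (apply Rdiv_lt_0_compat; lra).
destruct (uniform_continuity_2d_1d' f a b t (fun x _ => Hf t x) (mkposreal _ Heta))
  as [d Hd].
exists d. split; [apply cond_pos |]. intros s [_ Hs]. simpl in Hs |- *.
unfold Rdist in *.
assert (Hm := RInt_minus (V := R_CompleteNormedModule) _ _ a b (Hex s) (Hex t)).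
change (RInt (f s) a b - RInt (f t) a b)
  with (minus (RInt (f s) a b) (RInt (f t) a b)).
rewrite <- Hm.
apply Rle_lt_trans with ((b - a) * (eps / (b - a + 1))).
- apply abs_RInt_le_const; [assumption | |].
  + apply (ex_RInt_minus (V := R_NormedModule)); apply Hex.
  + intros x Hx. left. unfold Rabs in Hs. pose proof (cond_pos d).
    apply (Hd x t x s); try assumption.
    * lra.
    * destruct (Rcase_abs (s - t)); lra.
    * rewrite Rminus_diag, Rabs_R0. apply cond_pos.
- apply Rlt_le_trans with ((b - a + 1) * (eps / (b - a + 1))); [nra |].
  right. field. lra.
Qed.

Lemma locally_fst_pos (t x : R) : 0 < t ->
  locally (t, x) (fun p : R * R => 0 < fst p).
Proof.
intros Ht. apply (continuous_fst t x (fun y => 0 < y)). now apply open_gt.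
Qed.

(** Clamping is 1-Lipschitz, so [eps] itself is a valid radius. *)
Lemma continuous_clamp (p : R * R) :
  continuous (fun q : R * R => (Rmax 0 (fst q), snd q)) p.
Proof.
apply filterlim_locally. intros eps. exists eps. intros q [H1 H2].
split; [| exact H2].
apply Rle_lt_trans with (2 := H1). simpl.
unfold abs, minus, plus, opp; simpl. unfold Rmax, Rabs.
repeat destruct Rle_dec; repeat destruct Rcase_abs; lra.
Qed.

(** * Evolution of the cosine and sine coefficients of a solution *)

Section Solution.

Variables (kappa nu : R) (g : R -> R -> R).
Hypothesis Hg : linearized_solution kappa nu sin g.

(** Freezing the initial data at negative times turns continuity on the closed half-plane into
    continuity at every point. *)
Lemma solution_clamp_continuous (s x : R) :
  continuous (fun p : R * R => g (Rmax 0 (fst p)) (snd p)) (s, x).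
Proof.
intros P HP.
assert (H0 : 0 <= fst (Rmax 0 s, x)) by apply Rmax_l.
apply (sol_cont _ _ _ _ Hg _ H0) in HP.
apply (continuous_clamp (s, x)) in HP. unfold filtermap in *.
revert HP. apply filter_imp. intros q Hq. apply Hq. apply Rmax_l.
Qed.

Lemma solution_torus_C2 (t : R) : 0 < t ->
  torus_C2 (g t) (Derive (g t)) (Derive_n (g t) 2).
Proof.
intros Ht.
pose proof (sol_periodic _ _ _ _ Hg t (Rlt_le _ _ Ht)) as Hper.
split.
- intros x. apply Derive_correct, (sol_ex_dtheta _ _ _ _ Hg t x Ht).
- intros x. apply Derive_correct, (sol_ex_dtheta2 _ _ _ _ Hg t x Ht).
- intros x.
  apply (continuous_comp (fun y : R => (t, y))
           (fun p : R * R => Derive_n (g (fst p)) 2 (snd p))).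
  + intros P [eps HP]. exists eps. intros y Hy. apply HP.
    split; [apply ball_center | exact Hy].
  + apply (continuous_continuous_on _ _ _ (locally_fst_pos t x Ht)
             (sol_cont_dtheta2 _ _ _ _ Hg)).
- now rewrite <- (Hper 0), Rplus_0_l.
(* Periodicity passes to the derivative by differentiating [g t (x + 2 * PI) = g t x] at 0. *)
- rewrite <- (Rplus_0_l (2 * PI)).
  rewrite <- (Derive_ext (fun x => g t (x + 2 * PI)) (g t) 0 Hper).
  symmetry. apply is_derive_unique.
  apply (is_derive_ext (fun x => g t (x + 2 * PI))); [reflexivity |].
  pose proof (sol_ex_dtheta _ _ _ _ Hg t (0 + 2 * PI) Ht).
  auto_derive; auto.
  change (Derive (fun x => g t x)) with (Derive (g t)). ring.
Qed.

(** Differentiation under the integral, after which the equation replaces the time derivative by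
    [linearized_rhs]. *)
Lemma is_derive_solution_coeff (L c t : R) (e : R -> R) :
  harmonic L e -> kernel_eigenvalue c e -> 0 < t ->
  is_derive (fun s => RInt (fun x => g s x * e x) 0 (2 * PI)) t
    ((kappa / (2 * PI) * c - nu * L) * RInt (fun x => g t x * e x) 0 (2 * PI)).
Proof.
intros He Hc Ht. pose proof (harmonic_continuous _ _ He) as Hec.
assert (Hpos : locally t (fun s => 0 < s)) by now apply open_gt.
rewrite <- RInt_linearized_rhs; auto using solution_torus_C2.
rewrite (RInt_ext _ (fun x => Derive (fun s => g s x * e x) t)).
2:{ intros x _. rewrite Derive_scal_l. now rewrite (sol_eq _ _ _ _ Hg t x Ht). }
apply (is_derive_RInt_param (fun s x => g s x * e x)).
- revert Hpos. apply filter_imp. intros s Hs x _.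
  pose proof (sol_ex_dt _ _ _ _ Hg s x Hs). auto_derive; auto.
- intros x _.
  apply (continuity_2d_pt_ext (fun s y => Derive (fun z => g z y) s * e y)).
  { intros s y. symmetry. apply Derive_scal_l. }
  apply continuity_2d_pt_filterlim.
  apply (continuous_mult (K := R_AbsRing)
           (fun p : R * R => Derive (fun z => g z (snd p)) (fst p))
           (fun p : R * R => e (snd p)) (t, x)).
  + apply (continuous_continuous_on _ _ _ (locally_fst_pos t x Ht)
             (sol_cont_dt _ _ _ _ Hg)).
  + apply (continuous_comp snd e); [apply continuous_snd | apply Hec].
- revert Hpos. apply filter_imp. intros s Hs. apply ex_RInt_mult; auto.
  eapply torus_C2_continuous, solution_torus_C2, Hs.
Qed.

(** Integrating factor: the coefficient times [exp (- lam * s)] has zero derivative for [s > 0] and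
    is continuous up to 0, hence has equal values at 0 and [t]. *)
Lemma solution_coeff (L c t : R) (e : R -> R) :
  harmonic L e -> kernel_eigenvalue c e -> 0 <= t ->
  RInt (fun x => g t x * e x) 0 (2 * PI) =
  RInt (fun x => g 0 x * e x) 0 (2 * PI) * exp ((kappa / (2 * PI) * c - nu * L) * t).
Proof.
intros He Hc [Ht | <-].
2:{ now rewrite Rmult_0_r, exp_0, Rmult_1_r. }
pose proof (harmonic_continuous _ _ He) as Hec.
set (lam := kappa / (2 * PI) * c - nu * L).
(* MVT_gen wants two-sided continuity at 0, so time is clamped to [0, oo). *)
set (u := fun s => RInt (fun x => g (Rmax 0 s) x * e x) 0 (2 * PI)).
assert (Hu : forall s, continuity_pt u s).
{ intros s. apply (continuity_pt_RInt_param (fun s x => g (Rmax 0 s) x * e x));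
    [apply le_0_2PI |].
  intros r x. apply continuity_2d_pt_filterlim.
  apply (continuous_mult (K := R_AbsRing)
           (fun p : R * R => g (Rmax 0 (fst p)) (snd p))
           (fun p : R * R => e (snd p)) (r, x)).
  - apply solution_clamp_continuous.
  - apply (continuous_comp snd e); [apply continuous_snd | apply Hec]. }
assert (Hd : forall s, 0 < s -> is_derive u s (lam * u s)).
{ intros s Hs. apply (is_derive_ext_loc (fun s => RInt (fun x => g s x * e x) 0 (2 * PI))).
  - generalize (open_gt 0 s Hs). apply filter_imp. intros r Hr.
    unfold u. now rewrite Rmax_right by lra.
  - unfold u. rewrite Rmax_right by lra. now apply is_derive_solution_coeff. }
destruct (MVT_gen (fun s => u s * exp (- lam * s)) 0 t (fun _ => 0)) as [r [_ Hr]].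
- intros s. rewrite Rmin_left, Rmax_right by lra. intros [Hs _].
  specialize (Hd s Hs). auto_derive.
  + now exists (lam * u s).
  + change (Derive (fun x => u x)) with (Derive u).
    rewrite (is_derive_unique _ _ _ Hd). ring.
- intros s _. apply continuity_pt_mult; [apply Hu |].
  apply continuity_pt_filterlim.
  apply (ex_derive_continuous (K := R_AbsRing) (V := R_NormedModule)
           (fun s => exp (- lam * s))).
  auto_derive; auto.
- rewrite Rmult_0_l, Rmult_0_r, exp_0, Rmult_1_r in Hr. unfold u in Hr.
  rewrite Rmax_right, (Rmax_left 0 0) in Hr by lra.
  replace (RInt (fun x => g 0 x * e x) 0 (2 * PI))
    with (RInt (fun x => g t x * e x) 0 (2 * PI) * exp (- lam * t)) by lra.
  rewrite Rmult_assoc, <- exp_plus.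
  replace (- lam * t + lam * t) with 0 by ring. rewrite exp_0.
  symmetry. apply Rmult_1_r.
Qed.

End Solution.

(** * Complex Fourier coefficients and their growth rates *)

Lemma fourier_coeff_pair (f : R -> R) (l : Z) :
  (forall x, continuous f x) ->
  fourier_coeff f l =
  (/ (2 * PI) * RInt (fun x => f x * cos (IZR l * x)) 0 (2 * PI),
   - (/ (2 * PI) * RInt (fun x => f x * sin (IZR l * x)) 0 (2 * PI))).
Proof.
intros Hf. unfold fourier_coeff.
rewrite (is_RInt_unique (V := C_R_CompleteNormedModule) _ _ _
  (RInt (fun x => f x * cos (IZR l * x)) 0 (2 * PI),
   - RInt (fun x => f x * sin (IZR l * x)) 0 (2 * PI))).
- unfold scal; simpl. unfold prod_scal, scal; simpl. unfold mult; simpl.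
  f_equal. ring.
- apply (is_RInt_fct_extend_pair (U := R_NormedModule) (V := R_NormedModule)); simpl.
  + apply (RInt_correct (V := R_CompleteNormedModule)), ex_RInt_mult; auto.
    exact (harmonic_continuous _ _ (harmonic_cos l)).
  + apply (is_RInt_opp (V := R_NormedModule)
             (fun x => f x * sin (IZR l * x))).
    apply (RInt_correct (V := R_CompleteNormedModule)), ex_RInt_mult; auto.
    exact (harmonic_continuous _ _ (harmonic_sin l)).
Qed.

(** The number [lambda_l], with both cases in one formula. *)
Definition growth_rate (kappa nu : R) (l : Z) : R :=
  kappa / (2 * PI) * mode_eigenvalue l - nu * (IZR l * IZR l).

(** Differentiability in space is given only for [t > 0]; joint continuity of the clamped extension
    also covers [t = 0]. *)
Lemma solution_continuous (kappa nu : R) (g : R -> R -> R) (t : R) :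
  linearized_solution kappa nu sin g -> 0 <= t -> forall x, continuous (g t) x.
Proof.
intros Hg Ht x.
apply (continuous_ext (fun y => g (Rmax 0 t) y)).
{ intros y. now rewrite Rmax_right. }
apply (continuous_comp (fun y : R => (t, y))
         (fun p : R * R => g (Rmax 0 (fst p)) (snd p))).
- intros P [eps HP]. exists eps. intros y Hy. apply HP.
  split; [apply ball_center | exact Hy].
- eapply solution_clamp_continuous, Hg.
Qed.

(** The real and imaginary parts evolve with the same rate, so the complex coefficient is multiplied
    by one positive real number. *)
Lemma Cmod_fourier_coeff_solution (kappa nu : R) (g : R -> R -> R) (l : Z) (t : R) :
  linearized_solution kappa nu sin g -> 0 <= t ->
  Cmod (fourier_coeff (g t) l) =
  Cmod (fourier_coeff (g 0) l) * exp (growth_rate kappa nu l * t).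
Proof.
intros Hg Ht.
destruct (kernel_eigenvalue_mode l) as [Hc Hs].
rewrite !fourier_coeff_pair by (eapply solution_continuous; eauto; lra).
rewrite (solution_coeff _ _ _ Hg _ _ t _ (harmonic_cos l) Hc Ht),
  (solution_coeff _ _ _ Hg _ _ t _ (harmonic_sin l) Hs Ht).
fold (growth_rate kappa nu l).
set (E := exp (growth_rate kappa nu l * t)).
assert (HE : 0 < E) by apply exp_pos.
(* The third occurrence is the factor on the right; as the modulus of a real it merges by
   multiplicativity of [Cmod]. *)
rewrite <- (Rabs_pos_eq E) at 3 by lra.
rewrite <- Cmod_R, <- Cmod_mult. f_equal.
unfold Cmult, RtoC; simpl. f_equal; ring.
Qed.

(** Bounds every rate by [(kappa / 2 - nu) * l^2], without separating [l = 1, -1] from the other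
    modes. *)
Lemma mode_eigenvalue_le (l : Z) : l <> 0%Z ->
  mode_eigenvalue l <= PI * (IZR l * IZR l) /\ 1 <= IZR l * IZR l.
Proof.
intros Hl. rewrite <- mult_IZR.
assert (H1 : 1 <= IZR (l * l)) by (apply IZR_le; nia).
split; [| exact H1]. pose proof PI_RGT_0.
unfold mode_eigenvalue. destruct (l * l =? 1)%Z; nra.
Qed.

Lemma growth_rate_neg (kappa nu : R) (l : Z) :
  0 < kappa -> kappa / 2 < nu -> l <> 0%Z -> growth_rate kappa nu l < 0.
Proof.
intros Hk Hn Hl. destruct (mode_eigenvalue_le l Hl) as [H1 H2].
pose proof PI_RGT_0. unfold growth_rate.
apply Rle_lt_trans with
  (kappa / (2 * PI) * (PI * (IZR l * IZR l)) - nu * (IZR l * IZR l)).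
- apply Rplus_le_compat_r, Rmult_le_compat_l; [| exact H1].
  left. apply Rdiv_lt_0_compat; lra.
- replace (kappa / (2 * PI) * (PI * (IZR l * IZR l)))
    with (kappa / 2 * (IZR l * IZR l)) by (field; lra). nra.
Qed.

Lemma growth_rate_1 (kappa nu : R) : growth_rate kappa nu 1 = kappa / 2 - nu.
Proof.
unfold growth_rate, mode_eigenvalue; simpl. field. apply PI_neq0.
Qed.

(** * An explicit solution exciting the first mode *)

Definition cos_mode (a t theta : R) : R := exp (a * t) * cos theta.

Lemma cos_mode_continuous (a : R) (p : R * R) :
  continuous (fun q : R * R => cos_mode a (fst q) (snd q)) p.
Proof.
destruct p as [t x]. unfold cos_mode.
apply (continuous_mult (K := R_AbsRing)
         (fun q : R * R => exp (a * fst q)) (fun q : R * R => cos (snd q))).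
- apply (continuous_comp fst (fun t => exp (a * t))); [apply continuous_fst |].
  apply (ex_derive_continuous (K := R_AbsRing) (V := R_NormedModule)).
  auto_derive; auto.
- apply (continuous_comp snd cos); [apply continuous_snd | apply continuous_cos].
Qed.

Lemma Derive_cos_mode (a t x : R) :
  Derive (cos_mode a t) x = - (exp (a * t) * sin x).
Proof. apply is_derive_unique. unfold cos_mode. auto_derive; auto. ring. Qed.

Lemma is_derive_Derive_cos_mode (a t x : R) :
  is_derive (Derive (cos_mode a t)) x (- cos_mode a t x).
Proof.
apply (is_derive_ext (fun x => - (exp (a * t) * sin x))).
- intros y. symmetry. apply Derive_cos_mode.
- unfold cos_mode. auto_derive; auto. ring.
Qed.

Lemma Derive_n_cos_mode (a t x : R) :
  Derive_n (cos_mode a t) 2 x = - cos_mode a t x.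
Proof. apply is_derive_unique, is_derive_Derive_cos_mode. Qed.

Lemma Derive_time_cos_mode (a t x : R) :
  Derive (fun s => cos_mode a s x) t = a * cos_mode a t x.
Proof. apply is_derive_unique. unfold cos_mode. auto_derive; auto. ring. Qed.

Lemma RInt_cos_mode (a t : R) (e : R -> R) : (forall x, continuous e x) ->
  RInt (fun x => cos_mode a t x * e x) 0 (2 * PI) =
  exp (a * t) * RInt (fun x => cos x * e x) 0 (2 * PI).
Proof.
intros He.
rewrite <- (RInt_scal (V := R_CompleteNormedModule) (fun x => cos x * e x)).
- apply RInt_ext. intros x _. unfold cos_mode, scal; simpl; unfold mult; simpl. ring.
- apply ex_RInt_mult; auto using continuous_cos.
Qed.

Lemma cos_mode_continuous_space (a t x : R) : continuous (cos_mode a t) x.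
Proof.
apply (ex_derive_continuous (K := R_AbsRing) (V := R_NormedModule)).
unfold cos_mode. auto_derive; auto.
Qed.

Lemma cos_mode_solution (kappa nu : R) :
  linearized_solution kappa nu sin (cos_mode (kappa / 2 - nu)).
Proof.
set (a := kappa / 2 - nu). split.
- intros t _ x. unfold cos_mode.
  now rewrite cos_plus, cos_2PI, sin_2PI, Rmult_1_r, Rmult_0_r, Rminus_0_r.
- apply continuous_on_forall. intros p _. apply cos_mode_continuous.
- intros t x _. unfold cos_mode. auto_derive; auto.
- intros t x _. unfold cos_mode. auto_derive; auto.
- intros t x _. eexists. apply is_derive_Derive_cos_mode.
- apply continuous_on_forall. intros p _.
  apply (continuous_ext (fun p : R * R => a * cos_mode a (fst p) (snd p))).
  + intros q. symmetry. apply Derive_time_cos_mode.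
  + apply (continuous_scal_r (V := R_NormedModule)), cos_mode_continuous.
- apply continuous_on_forall. intros [t x] _.
  apply (continuous_ext (fun p : R * R => cos_mode a (fst p) (snd p + PI / 2))).
  + intros q. rewrite Derive_cos_mode. unfold cos_mode.
    rewrite cos_plus, cos_PI2, sin_PI2. simpl. ring.
  + apply (continuous_comp (fun p : R * R => (fst p, snd p + PI / 2))
             (fun q : R * R => cos_mode a (fst q) (snd q)));
      [| apply cos_mode_continuous].
    apply filterlim_locally. intros eps. exists eps. intros q [H1 H2].
    split; [exact H1 |]. revert H2. simpl.
    unfold ball; simpl; unfold AbsRing_ball, abs, minus, plus, opp; simpl.
    intros H2. apply Rle_lt_trans with (2 := H2). right. f_equal. ring.
- apply continuous_on_forall. intros p _.
  apply (continuous_ext (fun p : R * R => - cos_mode a (fst p) (snd p))).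
  + intros q. symmetry. apply Derive_n_cos_mode.
  + apply (continuous_opp (V := R_NormedModule)), cos_mode_continuous.
- intros t x _.
  (* The cosine moment is [exp (a * t) * PI] and the sine moment 0, so the kernel term has rate
     [kappa / 2]. *)
  rewrite Derive_time_cos_mode, linearized_rhs_sin by apply cos_mode_continuous_space.
  rewrite Derive_n_cos_mode.
  rewrite !RInt_cos_mode by auto using continuous_cos, continuous_sin.
  rewrite RInt_cos_cos, RInt_cos_sin. unfold cos_mode, a. field. apply PI_neq0.
Qed.

(** The real part of this coefficient is [1 / 2]. *)
Lemma fourier_coeff_cos_mode (a : R) : fourier_coeff (cos_mode a 0) 1 <> RtoC 0.
Proof.
rewrite fourier_coeff_pair by apply cos_mode_continuous_space.
rewrite (RInt_cos_mode a 0 (fun x => cos (1 * x)))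
  by exact (harmonic_continuous _ _ (harmonic_cos 1)).
rewrite (RInt_ext (fun x => cos x * cos (1 * x)) (fun x => cos x * cos x)).
2:{ intros x _. now rewrite Rmult_1_l. }
rewrite RInt_cos_cos, Rmult_0_r, exp_0.
intros H. apply (f_equal fst) in H. simpl in H.
replace (/ (2 * PI) * (1 * PI)) with (/ 2) in H by (field; apply PI_neq0). lra.
Qed.

Theorem corollary1p1 (kappa nu : R) (hkappa : 0 < kappa) (hnu : 0 < nu) :
  (kappa / nu < 2 -> linearly_stable kappa nu sin) /\
  (kappa / nu > 2 -> linearly_unstable kappa nu sin).
Proof.
(* Lets [nra] turn a bound on the quotient into a comparison of [kappa / 2] with [nu]. *)
assert (Hq : kappa = kappa / nu * nu) by (field; lra).
split; intros H.
- intros g Hg l Hl.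
  exists (Cmod (fourier_coeff (g 0) l)), (- growth_rate kappa nu l). split.
  + assert (Hlt : kappa / 2 < nu) by nra.
    pose proof (growth_rate_neg kappa nu l hkappa Hlt Hl). lra.
  + intros t Ht. rewrite Ropp_involutive.
    right. now apply Cmod_fourier_coeff_solution.
- exists 1%Z. split; [lia |]. split.
  + exists (cos_mode (kappa / 2 - nu)). split; [apply cos_mode_solution |].
    exists 0. split; [lra | apply fourier_coeff_cos_mode].
  + intros g Hg [t [Ht Hex]].
    exists (Cmod (fourier_coeff (g 0) 1)), (growth_rate kappa nu 1).
    split; [| split].
    (* A nonzero coefficient at time [t] forces a nonzero one at time 0, because the two moduli
       differ by a positive exponential factor. *)
    * apply Cmod_gt_0 in Hex.
      rewrite (Cmod_fourier_coeff_solution _ _ _ _ _ Hg Ht) in Hex.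
      pose proof (exp_pos (growth_rate kappa nu 1 * t)).
      pose proof (Cmod_ge_0 (fourier_coeff (g 0) 1)). nra.
    * rewrite growth_rate_1. nra.
    * intros s Hs. right. symmetry. now apply Cmod_fourier_coeff_solution.
Qed.
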